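(* Let $a,b,c,d,e,f,n$ be complex parameters and let $$F(n,k,a):=\frac{(a)_{k+f}\,(b)_{k+e}}{(n)_{k+d+a}\,(n)_{k+c}},\qquad \mathfrak f(n,a):=\sum_{k=0}^{\infty}F(n,k,a),$$ and let $g_5,g_6$ be the associated functions defined in the context. Suppose that the standing assumptions (i)--(iv) listed in the context hold. Then the acceleration identity (of iteration pattern $(1,1)$) $$\mathfrak f(n,a)=\sum_{j=0}^{\infty}\left(\prod_{i=0}^{j-1}g_6(n+i,a+i)\right)g_5(n+j,a+j)$$ holds.
   Context: Rising factorials with arbitrary index are $(x)_y=\Gamma(x+y)/\Gamma(x)$; an empty product is $1$. The parameters $b,c,d,e,f$ are fixed throughout, while $n$ and $a$ are shifted by integers. Put $A=a+f$, $B=b+e$, $C=n+c$, $D=n+a+d$, $s=A+B-C-D=b-c-d+e+f-2n$ (all functions of $(n,a)$), and define $$p_1(n,a)=(D-A)(A-C)(C-B)(D-B)=(d-f+n)(a-c+f-n)(-b+c-e+n)(a-b+d-e+n),$$ $$p_2(n,a)=n^2\,s\,(s+1),\qquad R(n,k,a)=n^2\big(sk+s(C+D-1)-AB+CD\big),$$ $$p_3(n,a)=a(-a+b-d+e-n),\qquad p_4(n,a)=a-c+f-n+1,\qquad \mathcal R(n,k,a)=c+k+n-1,$$ $$G(n,k,a)=R(n,k,a)F(n,k,a),\qquad \mathcal G(n,k,a)=\mathcal R(n,k,a)F(n,k,a).$$ (These are the data of the first-order recurrences $p_1F(n+1,k,a)+p_2F(n,k,a)=G(n,k+1,a)-G(n,k,a)$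 and $p_3F(n,k,a+1)+p_4F(n,k,a)=\mathcal G(n,k+1,a)-\mathcal G(n,k,a)$ produced by Zeilberger's algorithm.) Set $$g_1=-\frac{G(n,0,a)}{p_2(n,a)},\quad g_2=-\frac{p_1(n,a)}{p_2(n,a)},\quad g_3=-\frac{\mathcal G(n,0,a)}{p_4(n,a)},\quad g_4=-\frac{p_3(n,a)}{p_4(n,a)},$$ $$g_5(n,a)=g_1(n,a)+g_2(n,a)\,g_3(n+1,a),\qquad g_6(n,a)=g_2(n,a)\,g_4(n+1,a).$$ Standing assumptions, required for every integer $j\ge 0$: (i) all Gamma functions occurring in $F(n+j,k,a+j)$ and $F(n+j+1,k,a+j)$, $k\ge 0$, are evaluated away from their poles, and $p_2(n+j,a+j)\neq0$, $p_4(n+j+1,a+j)\ne 0$; (ii) the series defining $\mathfrak f(n+j,a+j)$ and $\mathfrak f(n+j+1,a+j)$ converge; (iii) $\lim_{k\to\infty}G(n+j,k,a+j)=0$ and $\lim_{k\to\infty}\mathcal G(n+j+1,k,a+j)=0$; (iv) $\lim_{m\to\infty}\Big(\prod_{i=0}^{m}g_6(n+i,a+i)\Big)\mathfrak f(n+m+1,a+m+1)=0$. *)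

(* Defs.v *)
From Stdlib Require Import Reals Factorial.
From Coquelicot Require Export Coquelicot.

Open Scope C_scope.

Definition NtoC (k : nat) : C := RtoC (INR k).
Coercion NtoC : nat >-> C.

(* [Cprod u m] is the product of u 0, ..., u (m - 1). *)
Fixpoint Cprod (u : nat -> C) (m : nat) : C :=
  match m with
  | O => 1
  | S m' => Cprod u m' * u m'
  end.

(* Componentwise, hence meaningful only when the sequence converges in C. *)
Definition Clim_seq (u : nat -> C) : C :=
  (real (Lim_seq (fun m => Re (u m))), real (Lim_seq (fun m => Im (u m)))).

(* C carries two Coquelicot normed-module structures (over R and over itself);
   these fix the one over itself. *)
Notation is_Cseries := (@is_series C_AbsRing C_NormedModule).
Notation ex_Cseries := (@ex_series C_AbsRing C_NormedModule).

Definition is_Clim_seq (u : nat -> C) (l : C) : Prop :=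
  filterlim u eventually (@locally C_UniformSpace l).

Definition CSeries (u : nat -> C) : C :=
  Clim_seq (@sum_n C_AbelianMonoid u).

Definition Cexp (z : C) : C :=
  RtoC (exp (Re z)) * (cos (Im z), sin (Im z)).

(* Gauss's formula
     Gamma z = lim_m  m! m^z / (z (z + 1) ... (z + m)),
   valid for every z which is not a pole, with m^z = exp (z ln m). *)
Definition Gamma (z : C) : C :=
  Clim_seq (fun m =>
    NtoC (fact m) * Cexp (z * RtoC (ln (INR m)))
      / Cprod (fun i => z + i) (S m)).

Definition Gamma_pole (z : C) : Prop := exists m : nat, z = - m.

Definition rising (x y : C) : C := Gamma (x + y) / Gamma x.

Definition rising_regular (x y : C) : Prop :=
  ~ Gamma_pole (x + y) /\ ~ Gamma_pole x.

Section Acceleration.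

Context (b c d e f : C).

Definition F (n : C) (k : nat) (a : C) : C :=
  (rising a (k + f) * rising b (k + e))
    / (rising n (k + d + a) * rising n (k + c)).

Definition F_regular (n : C) (k : nat) (a : C) : Prop :=
  rising_regular a (k + f) /\ rising_regular b (k + e) /\
  rising_regular n (k + d + a) /\ rising_regular n (k + c).

Definition frakf (n a : C) : C := CSeries (fun k => F n k a).

Definition parA (n a : C) : C := a + f.
Definition parB (n a : C) : C := b + e.
Definition parC (n a : C) : C := n + c.
Definition parD (n a : C) : C := n + a + d.
Definition pars (n a : C) : C := parA n a + parB n a - parC n a - parD n a.

Definition p1 (n a : C) : C :=
  (parD n a - parA n a) * (parA n a - parC n a)
  * (parC n a - parB n a) * (parD n a - parB n a).

Definition p2 (n a : C) : C := n ^ 2 * pars n a * (pars n a + 1).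

Definition certR (n : C) (k : nat) (a : C) : C :=
  n ^ 2 * (pars n a * k + pars n a * (parC n a + parD n a - 1)
           - parA n a * parB n a + parC n a * parD n a).

Definition p3 (n a : C) : C := a * (- a + b - d + e - n).

Definition p4 (n a : C) : C := a - c + f - n + 1.

Definition calR (n : C) (k : nat) (a : C) : C := c + k + n - 1.

Definition G (n : C) (k : nat) (a : C) : C := certR n k a * F n k a.

Definition calG (n : C) (k : nat) (a : C) : C := calR n k a * F n k a.

Definition g1 (n a : C) : C := - (G n 0 a / p2 n a).
Definition g2 (n a : C) : C := - (p1 n a / p2 n a).
Definition g3 (n a : C) : C := - (calG n 0 a / p4 n a).
Definition g4 (n a : C) : C := - (p3 n a / p4 n a).

Definition g5 (n a : C) : C := g1 n a + g2 n a * g3 (n + 1) a.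
Definition g6 (n a : C) : C := g2 n a * g4 (n + 1) a.

End Acceleration.

(* Main.v *)
Require Import Defs.
From Stdlib Require Import Reals Factorial Lra Lia ssreflect.
From Coquelicot Require Import Coquelicot.

(** The identity is an iterated pair of first-order recurrences.  Summing
    [p1 F(n+1,k,a) + p2 F(n,k,a) = G(n,k+1,a) - G(n,k,a)] over [k] telescopes
    the right-hand side to [- G(n,0,a)] and expresses [frakf n a] through
    [frakf (n+1) a] ([frakf_succ_n]); the recurrence in [a] likewise expresses
    [frakf (n+1) a] through [frakf (n+1) (a+1)] ([frakf_succ_a]).  Together,
    [frakf n a = g5 n a + g6 n a * frakf (n+1) (a+1)], and iterating this along
    the diagonal telescopes once more ([is_Cseries_iterate]), with the
    assumption on the remainder giving convergence.

    Both recurrences are identities of rational functions once the quotients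
    of [F] at neighbouring arguments are known ([F_succ_k], [F_succ_n],
    [F_succ_a]), and these quotients only require
    [Gamma (z + 1) = z * Gamma z] away from the poles ([Gamma_succ]).

    The analytic content is thus the functional equation of a Gamma function
    defined by Gauss's limit, and there the point is that the limit exists.
    Consecutive terms of Gauss's sequence differ by a factor
    [1 + O(1/m^2)] ([gauss_seq_increment_bound]), so the sequence behaves like
    the partial products of an absolutely convergent infinite product
    ([ex_Clim_seq_relative_increments]).  Given convergence, the functional
    equation follows by passing to the limit in an elementary relation between
    the sequences at [z] and [z + 1] ([gauss_seq_succ]). *)

(** * Limits of complex sequences *)

Open Scope R_scope.

Lemma is_Clim_seq_Re_Im (u : nat -> C) (l : C) :
  is_Clim_seq u l <->
  is_lim_seq (fun m => Re (u m)) (Re l) /\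
  is_lim_seq (fun m => Im (u m)) (Im l).
Proof.
  split.
  - intros H.
    assert (H' := proj1 (filterlim_locally u l) H).
    split; apply filterlim_locally; intros eps;
      apply: filter_imp (H' eps); intros m [Hre Him]; assumption.
  - intros [Hre Him].
    apply filterlim_locally; intros eps.
    assert (Hre' := proj1 (filterlim_locally _ _) Hre eps).
    assert (Him' := proj1 (filterlim_locally _ _) Him eps).
    apply: filter_imp (filter_and _ _ Hre' Him').
    intros m [H1 H2]; split; assumption.
Qed.

Lemma is_Clim_seq_unique (u : nat -> C) (l : C) :
  is_Clim_seq u l -> Clim_seq u = l.
Proof.
  intros [Hre Him]%is_Clim_seq_Re_Im; unfold Clim_seq.
  rewrite (is_lim_seq_unique _ _ Hre) (is_lim_seq_unique _ _ Him).
  now destruct l.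
Qed.

Lemma is_Clim_seq_const (x : C) : is_Clim_seq (fun _ => x) x.
Proof. apply filterlim_const. Qed.

Lemma is_Clim_seq_minus (u v : nat -> C) (lu lv : C) :
  is_Clim_seq u lu -> is_Clim_seq v lv ->
  is_Clim_seq (fun m => u m - v m)%C (lu - lv)%C.
Proof.
  intros [Hu Hu']%is_Clim_seq_Re_Im [Hv Hv']%is_Clim_seq_Re_Im.
  apply is_Clim_seq_Re_Im; split; apply is_lim_seq_minus'; assumption.
Qed.

Lemma is_Clim_seq_mult (u v : nat -> C) (lu lv : C) :
  is_Clim_seq u lu -> is_Clim_seq v lv ->
  is_Clim_seq (fun m => u m * v m)%C (lu * lv)%C.
Proof.
  intros [Hu Hu']%is_Clim_seq_Re_Im [Hv Hv']%is_Clim_seq_Re_Im.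
  apply is_Clim_seq_Re_Im; split;
    [apply is_lim_seq_minus' | apply is_lim_seq_plus'];
    apply is_lim_seq_mult'; assumption.
Qed.

Lemma is_Clim_seq_ext (u v : nat -> C) (l : C) :
  (forall m, u m = v m) -> is_Clim_seq u l -> is_Clim_seq v l.
Proof. intros H; apply filterlim_ext, H. Qed.

Lemma is_Clim_seq_ext_loc (u v : nat -> C) (l : C) :
  eventually (fun m => u m = v m) -> is_Clim_seq u l -> is_Clim_seq v l.
Proof. intros H; now apply filterlim_ext_loc. Qed.

Lemma is_Clim_seq_incr_1 (u : nat -> C) (l : C) :
  is_Clim_seq u l -> is_Clim_seq (fun m => u (S m)) l.
Proof.
  intros [Hre Him]%is_Clim_seq_Re_Im.
  apply is_Clim_seq_Re_Im; split;
    [apply (is_lim_seq_incr_1 (fun m => Re (u m)))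
    |apply (is_lim_seq_incr_1 (fun m => Im (u m)))]; assumption.
Qed.

Lemma is_Clim_seq_incr_n (u : nat -> C) (N : nat) (l : C) :
  is_Clim_seq (fun m => u (m + N)%nat) l -> is_Clim_seq u l.
Proof.
  intros [Hre Him]%is_Clim_seq_Re_Im.
  apply is_Clim_seq_Re_Im; split;
    [apply (is_lim_seq_incr_n (fun m => Re (u m)) N)
    |apply (is_lim_seq_incr_n (fun m => Im (u m)) N)]; assumption.
Qed.

Lemma im_le_Cmod (x : C) : Rabs (Im x) <= Cmod x.
Proof. eapply Rle_trans, Rmax_Cmod; apply Rmax_r. Qed.

Lemma Cmod_le_Re_Im (x : C) : Cmod x <= Rabs (Re x) + Rabs (Im x).
Proof.
  destruct x as [x y]; unfold Cmod, Re, Im; simpl fst; simpl snd.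
  assert (Hx := Rabs_pos x); assert (Hy := Rabs_pos y).
  rewrite -(sqrt_Rsqr (Rabs x + Rabs y)); [|lra].
  apply sqrt_le_1_alt; unfold Rsqr.
  rewrite -(pow2_abs x) -(pow2_abs y); nra.
Qed.

Lemma Cmod_minus_sym (x y : C) : Cmod (x - y) = Cmod (y - x).
Proof. rewrite -Cmod_opp; f_equal; ring. Qed.

Lemma Clim_seq_cauchy_ex (u : nat -> C) :
  (forall eps : posreal, exists N : nat, forall p q : nat,
     (N <= p)%nat -> (N <= q)%nat -> Cmod (u p - u q) < eps) ->
  exists l, is_Clim_seq u l.
Proof.
  intros H.
  assert (Hre : ex_lim_seq_cauchy (fun m => Re (u m))).
  { intros eps; destruct (H eps) as [N HN]; exists N; intros p q Hp Hq.
    eapply Rle_lt_trans, (HN p q); auto.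
    exact (re_le_Cmod (u p - u q)). }
  assert (Him : ex_lim_seq_cauchy (fun m => Im (u m))).
  { intros eps; destruct (H eps) as [N HN]; exists N; intros p q Hp Hq.
    eapply Rle_lt_trans, (HN p q); auto.
    exact (im_le_Cmod (u p - u q)). }
  apply ex_lim_seq_cauchy_corr in Hre as [x Hx].
  apply ex_lim_seq_cauchy_corr in Him as [y Hy].
  exists (x, y); apply is_Clim_seq_Re_Im; now split.
Qed.

(** A convergence test for infinite products, [u m] being the partial
    products: the relative increments are bounded by the decrements of a null
    sequence [t].  Then [Cmod (u m) * exp (t m)] is nonincreasing because
    [1 + x <= exp x], so [u] is bounded, and the increments of [u] are
    dominated by a telescoping sum. *)
Lemma ex_Clim_seq_relative_increments (u : nat -> C) (t : nat -> R) :
  (forall m, t (S m) <= t m) -> is_lim_seq t 0 ->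
  (forall m, Cmod (u (S m) - u m) <= (t m - t (S m)) * Cmod (u m)) ->
  exists l, is_Clim_seq u l.
Proof.
  intros Hdec Ht0 Hu.
  assert (Ht : forall m, 0 <= t m).
  { intros m; now apply (is_lim_seq_decr_compare t 0). }
  pose (B := Cmod (u O) * exp (t O)).
  assert (HB : forall m, Cmod (u m) * exp (t m) <= B).
  { induction m as [|m IH]; [apply Rle_refl|].
    eapply Rle_trans, IH.
    assert (Hstep : Cmod (u (S m)) <= (1 + (t m - t (S m))) * Cmod (u m)).
    { replace (u (S m)) with ((u (S m) - u m) + u m)%C by ring.
      eapply Rle_trans; [apply Cmod_triangle|].
      specialize (Hu m); lra. }
    replace (exp (t m)) with (exp (t m - t (S m)) * exp (t (S m)))
      by (rewrite -exp_plus; f_equal; ring).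
    rewrite -Rmult_assoc.
    apply Rmult_le_compat_r; [left; apply exp_pos|].
    rewrite (Rmult_comm (Cmod (u m))).
    eapply Rle_trans; [exact Hstep|].
    apply Rmult_le_compat_r; [apply Cmod_ge_0|apply exp_ineq1_le]. }
  assert (HB' : forall m, Cmod (u m) <= B).
  { intros m; eapply Rle_trans, (HB m).
    assert (H1 := exp_ineq1_le (t m)).
    assert (H2 := Ht m); assert (H3 := Cmod_ge_0 (u m)); nra. }
  assert (B0 : 0 <= B) by (eapply Rle_trans, (HB' O); apply Cmod_ge_0).
  assert (Htel : forall p k, Cmod (u (p + k)%nat - u p)
                             <= (t p - t (p + k)%nat) * B).
  { intros p; induction k as [|k IH].
    - rewrite Nat.add_0_r; replace (u p - u p)%C with (RtoC 0) by ring.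
      rewrite Cmod_0; lra.
    - rewrite Nat.add_succ_r.
      replace (u (S (p + k)) - u p)%C
        with ((u (S (p + k)) - u (p + k)%nat) + (u (p + k)%nat - u p))%C
        by ring.
      eapply Rle_trans; [apply Cmod_triangle|].
      assert (H1 := Hu (p + k)%nat); assert (H2 := Hdec (p + k)%nat).
      assert (H3 := HB' (p + k)%nat); nra. }
  apply Clim_seq_cauchy_ex; intros eps.
  assert (Heps : 0 < eps / (2 * (B + 1)))
    by (apply Rdiv_lt_0_compat; [apply eps|lra]).
  apply is_lim_seq_spec in Ht0.
  destruct (Ht0 (mkposreal _ Heps)) as [N HN].
  exists N; intros p q Hp Hq.
  assert (HNsmall : t N * B < eps / 2).
  { specialize (HN N (le_n N)); simpl in HN.
    rewrite Rminus_0_r Rabs_pos_eq in HN; [|apply Ht].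
    apply Rle_lt_trans with (t N * (B + 1)); [specialize (Ht N); nra|].
    apply Rmult_lt_compat_r with (r := B + 1) in HN; [|lra].
    replace (eps / 2) with (eps / (2 * (B + 1)) * (B + 1)) by (field; lra).
    exact HN. }
  assert (Hfrom : forall q, (N <= q)%nat -> Cmod (u q - u N) < eps / 2).
  { intros r Hr; replace r with (N + (r - N))%nat by lia.
    eapply Rle_lt_trans; [apply Htel|].
    specialize (Ht (N + (r - N))%nat); nra. }
  replace (u p - u q)%C with ((u p - u N) + (u N - u q))%C by ring.
  eapply Rle_lt_trans; [apply Cmod_triangle|].
  rewrite (Cmod_minus_sym (u N)).
  assert (H1 := Hfrom p Hp); assert (H2 := Hfrom q Hq); lra.
Qed.

(** * The complex exponential *)

Lemma Cexp_plus (z w : C) : Cexp (z + w)%C = (Cexp z * Cexp w)%C.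
Proof.
  destruct z as [x y], w as [x' y']; unfold Cexp, Re, Im; simpl.
  rewrite exp_plus cos_plus sin_plus.
  apply injective_projections; simpl; ring.
Qed.

Lemma Cexp_RtoC (x : R) : Cexp x = RtoC (exp x).
Proof.
  unfold Cexp; simpl; rewrite cos_0 sin_0.
  apply injective_projections; simpl; ring.
Qed.

Lemma exp_taylor1_bound (x : R) :
  Rabs x <= / 2 -> Rabs (exp x - 1 - x) <= 2 * x ^ 2.
Proof.
  intros Hx%Rabs_le_between.
  assert (Hlow := exp_ineq1_le x).
  (* The upper bound comes from [exp x = / exp (- x) <= / (1 - x)]. *)
  assert (Hup : exp x * (1 - x) <= 1).
  { assert (H := exp_ineq1_le (- x)); assert (H0 := exp_pos x).
    replace 1 with (exp x * exp (- x)) at 2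
      by (rewrite -exp_plus Rplus_opp_r; apply exp_0).
    apply Rmult_le_compat_l; lra. }
  apply Rabs_le; split; [nra|].
  assert (exp x * (1 - x) <= (1 + x + 2 * x ^ 2) * (1 - x)) by nra.
  assert (exp x <= 1 + x + 2 * x ^ 2)
    by (apply Rmult_le_reg_r with (1 - x); lra).
  lra.
Qed.

Lemma Rabs_sin_le (x : R) : Rabs (sin x) <= Rabs x.
Proof.
  destruct (MVT_abs sin cos 0 x) as [c [H _]].
  { intros c _; apply derivable_pt_lim_sin. }
  rewrite sin_0 !Rminus_0_r in H; rewrite H.
  assert (Hc : Rabs (cos c) <= 1) by (apply Rabs_le, COS_bound).
  assert (H0 := Rabs_pos x); nra.
Qed.

Lemma cos_taylor1_bound (y : R) : Rabs (cos y - 1) <= y ^ 2 / 2.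
Proof.
  replace y with (2 * (y / 2)) at 1 by field.
  rewrite cos_2a_sin.
  assert (H := Rabs_sin_le (y / 2)); apply Rsqr_le_abs_1 in H.
  unfold Rsqr in H; apply Rabs_le; nra.
Qed.

Lemma sin_taylor1_bound (y : R) : Rabs y <= 1 -> Rabs (sin y - y) <= y ^ 2.
Proof.
  intros Hy.
  destruct (MVT_abs (fun x => sin x - x) (fun x => cos x - 1) 0 y)
    as [c [H [Hc1 Hc2]]].
  { intros c _; apply (derivable_pt_lim_minus sin id).
    - apply derivable_pt_lim_sin.
    - apply derivable_pt_lim_id. }
  rewrite sin_0 !Rminus_0_r in H; rewrite H.
  assert (Hcy : Rabs c <= Rabs y).
  { revert Hc1 Hc2; unfold Rmin, Rmax; destruct (Rle_dec 0 y); intros;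
      unfold Rabs; destruct (Rcase_abs c), (Rcase_abs y); lra. }
  assert (Hcos := cos_taylor1_bound c).
  rewrite -(pow2_abs c) in Hcos; rewrite -(pow2_abs y).
  assert (H0 := Rabs_pos c); assert (H1 := Rabs_pos y).
  assert (Rabs (cos c - 1) <= Rabs y) by nra.
  nra.
Qed.

(** In coordinates [w = (x, y)] the error is
    [exp x * (cos y - 1) + (exp x - 1 - x)] and
    [exp x * (sin y - y) + (exp x - 1) * y], each term being of order at least 2. *)
Lemma Cexp_taylor1_bound (w : C) :
  Cmod w <= / 2 -> Cmod (Cexp w - 1 - w) <= 4 * Cmod w ^ 2.
Proof.
  intros Hw.
  assert (Hx := re_le_Cmod w); assert (Hy := im_le_Cmod w).
  assert (Hmod : Cmod w ^ 2 = Re w ^ 2 + Im w ^ 2).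
  { unfold Cmod, Re, Im; rewrite pow2_sqrt; [reflexivity|nra]. }
  rewrite Hmod; clear Hmod; destruct w as [x y].
  unfold Re, Im in *; simpl fst in *; simpl snd in *.
  eapply Rle_trans; [apply Cmod_le_Re_Im|].
  replace (Re (Cexp (x, y) - 1 - (x, y))%C)
    with (exp x * (cos y - 1) + (exp x - 1 - x)) by (simpl; ring).
  replace (Im (Cexp (x, y) - 1 - (x, y))%C)
    with (exp x * (sin y - y) + (exp x - 1) * y) by (simpl; ring).
  assert (He := exp_taylor1_bound x ltac:(lra)).
  assert (Hc := cos_taylor1_bound y).
  assert (Hs := sin_taylor1_bound y ltac:(lra)).
  assert (He1 : Rabs (exp x - 1) <= 2 * Rabs x).
  { replace (exp x - 1) with ((exp x - 1 - x) + x) by ring.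
    eapply Rle_trans; [apply Rabs_triang|].
    rewrite -(pow2_abs x) in He; assert (H0 := Rabs_pos x); nra. }
  assert (He2 : 0 <= exp x <= 2).
  { split; [left; apply exp_pos|].
    apply Rabs_le_between in He1; lra. }
  assert (H1 : Rabs (exp x * (cos y - 1)) <= y ^ 2).
  { rewrite Rabs_mult (Rabs_pos_eq (exp x)); [|lra].
    assert (H0 := Rabs_pos (cos y - 1)); nra. }
  assert (H2 : Rabs (exp x * (sin y - y)) <= 2 * y ^ 2).
  { rewrite Rabs_mult (Rabs_pos_eq (exp x)); [|lra].
    assert (H0 := Rabs_pos (sin y - y)); nra. }
  assert (H3 : Rabs ((exp x - 1) * y) <= x ^ 2 + y ^ 2).
  { rewrite Rabs_mult -(pow2_abs x) -(pow2_abs y).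
    assert (H0 := Rabs_pos x); assert (H0' := Rabs_pos y).
    assert (H0'' := pow2_ge_0 (Rabs x - Rabs y)); nra. }
  assert (H4 := Rabs_triang (exp x * (cos y - 1)) (exp x - 1 - x)).
  assert (H5 := Rabs_triang (exp x * (sin y - y)) ((exp x - 1) * y)).
  assert (H6 := pow2_ge_0 x); assert (H7 := pow2_ge_0 y); lra.
Qed.

(** * The functional equation of the Gamma function *)

(** Both bounds are [ln y <= y - 1], at [y = x / (x + 1)] and at
    [y = (x + 1) / x]. *)
Lemma ln_succ_ratio_bounds (x : R) :
  0 < x -> / (x + 1) <= ln (x + 1) - ln x <= / x.
Proof.
  intros Hx.
  assert (Hle : forall y, 0 < y -> ln y <= y - 1).
  { intros y Hy; assert (H := exp_ineq1_le (ln y)).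
    rewrite exp_ln in H; lra. }
  split.
  - assert (H := Hle (x / (x + 1)) ltac:(apply Rdiv_lt_0_compat; lra)).
    rewrite ln_div in H; [|lra|lra].
    replace (x / (x + 1) - 1) with (- / (x + 1)) in H by (field; lra).
    lra.
  - assert (H := Hle ((x + 1) / x) ltac:(apply Rdiv_lt_0_compat; lra)).
    rewrite ln_div in H; [|lra|lra].
    replace ((x + 1) / x - 1) with (/ x) in H by (field; lra).
    lra.
Qed.

Open Scope C_scope.

Lemma NtoC_S (m : nat) : NtoC (S m) = m + 1.
Proof. unfold NtoC; now rewrite S_INR RtoC_plus. Qed.

Lemma Gamma_pole_shift (z : C) (m : nat) : ~ Gamma_pole z -> z + m <> 0.
Proof.
  intros Hz H; apply Hz; exists m.
  replace z with (z + m - m) by ring; rewrite H; ring.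
Qed.

Lemma Gamma_pole_ne_0 (z : C) : ~ Gamma_pole z -> z <> 0.
Proof. intros Hz ->; apply Hz; exists O; unfold NtoC; simpl; ring. Qed.

Lemma Cprod_neq_0 (u : nat -> C) (m : nat) :
  (forall i, u i <> 0) -> Cprod u m <> 0.
Proof.
  intros Hu; induction m as [|m IH]; simpl.
  - exact C1_nz.
  - apply Cmult_neq_0; auto.
Qed.

Definition gauss_seq (z : C) (m : nat) : C :=
  NtoC (fact m) * Cexp (z * RtoC (ln (INR m))) / Cprod (fun i => z + i) (S m).

Lemma gauss_seq_increment (z : C) (m : nat) :
  ~ Gamma_pole z ->
  gauss_seq z (S m) - gauss_seq z m =
  gauss_seq z m *
    ((NtoC (S m) * Cexp (z * RtoC (ln (INR (S m)) - ln (INR m)))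
      - (z + S m)) / (z + S m)).
Proof.
  intros Hz.
  assert (Hm := Gamma_pole_shift z (S m) Hz).
  assert (HP : Cprod (fun i => z + i) (S m) <> 0)
    by (apply Cprod_neq_0; intros i; now apply Gamma_pole_shift).
  unfold gauss_seq.
  replace (z * RtoC (ln (INR (S m))))
    with (z * RtoC (ln (INR m)) + z * RtoC (ln (INR (S m)) - ln (INR m)))
    by (rewrite RtoC_minus; ring).
  rewrite Cexp_plus.
  replace (NtoC (fact (S m))) with (NtoC (S m) * NtoC (fact m))
    by (unfold NtoC; rewrite -RtoC_mult -mult_INR; reflexivity).
  change (Cprod (fun i => z + i) (S (S m)))
    with (Cprod (fun i => z + i) (S m) * (z + S m)).
  revert Hm HP; generalize (Cprod (fun i => z + i) (S m)); intros P Hm HP.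
  field; now split.
Qed.

(** The increment factor is [O(1/m^2)]: with [L = ln (m+1) - ln m], both
    [Cexp (z * L)] and [1 + z / (m+1)] agree with [1 + z * L] up to
    [O(1/m^2)].  The bound is put in the telescoping form [1/m - 1/(m+1)].
    Taking [m] at least [2 * Cmod z] keeps [z * L] in the disc where the
    exponential was expanded and the denominator [z + (m+1)] above
    [(m+1) / 2]. *)
Lemma gauss_seq_increment_bound (z : C) (m : nat) :
  ~ Gamma_pole z -> (1 <= m)%nat -> (2 * Cmod z <= INR m)%R ->
  (Cmod (gauss_seq z (S m) - gauss_seq z m) <=
   ((16 * Cmod z ^ 2 + 2 * Cmod z) * (/ INR m - / INR (S m)))
   * Cmod (gauss_seq z m))%R.
Proof.
  intros Hz Hm1 Hmz.
  rewrite gauss_seq_increment // Cmod_mult Rmult_comm.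
  apply Rmult_le_compat_r; [apply Cmod_ge_0|].
  assert (Hden := Gamma_pole_shift z (S m) Hz).
  rewrite Cmod_div //.
  assert (Hm : (1 <= INR m)%R) by (apply (le_INR 1); exact Hm1).
  unfold NtoC in *; rewrite S_INR in Hden |- *.
  set (x := INR m) in *; set (L := (ln (x + 1) - ln x)%R).
  destruct (ln_succ_ratio_bounds x) as [HL1 HL2]; [lra|]; fold L in HL1, HL2.
  assert (Hr0 := Cmod_ge_0 z); set (r := Cmod z) in *.
  assert (Hx1 : (0 < / (x + 1))%R) by (apply Rinv_0_lt_compat; lra).
  assert (Hx0 : (0 < / x)%R) by (apply Rinv_0_lt_compat; lra).
  assert (HxV : (x * / x = 1)%R) by (field; lra).
  assert (HxV1 : ((x + 1) * / (x + 1) = 1)%R) by (field; lra).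
  assert (Hdiff : (/ x - / (x + 1) = / x * / (x + 1))%R) by (field; lra).
  assert (HzL : Cmod (z * RtoC L) = (r * L)%R).
  { rewrite Cmod_mult Cmod_R Rabs_pos_eq //; lra. }
  assert (HrL : (r * L <= r * / x)%R) by nra.
  assert (Hexp : (Cmod (Cexp (z * RtoC L) - 1 - z * RtoC L)
                  <= 4 * (r * / x) ^ 2)%R).
  { eapply Rle_trans; [apply Cexp_taylor1_bound; rewrite HzL; nra|].
    rewrite HzL.
    assert (0 <= r * L)%R by (apply Rmult_le_pos; lra).
    nra. }
  assert (Hlin : (Cmod (z * RtoC (L - / (x + 1)))
                  <= r * (/ x - / (x + 1)))%R).
  { rewrite Cmod_mult Cmod_R Rabs_pos_eq; [|lra].
    apply Rmult_le_compat_l; lra. }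
  assert (Hnum : (Cmod (RtoC (x + 1) * Cexp (z * RtoC L) - (z + RtoC (x + 1)))
     <= (x + 1) * (4 * (r * / x) ^ 2 + r * (/ x - / (x + 1))))%R).
  { replace (RtoC (x + 1) * Cexp (z * RtoC L) - (z + RtoC (x + 1)))
      with (RtoC (x + 1) * ((Cexp (z * RtoC L) - 1 - z * RtoC L)
                            + z * RtoC (L - / (x + 1)))).
    - rewrite Cmod_mult Cmod_R Rabs_pos_eq; [|lra].
      apply Rmult_le_compat_l; [lra|].
      eapply Rle_trans; [apply Cmod_triangle|lra].
    - rewrite RtoC_minus RtoC_inv; [|lra].
      field; intros H; apply RtoC_inj in H; lra. }
  assert (Hdenlow : ((x + 1) / 2 <= Cmod (z + RtoC (x + 1)))%R).
  { assert (H := Cmod_triangle (z + RtoC (x + 1)) (- z)).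
    replace (z + RtoC (x + 1) + - z) with (RtoC (x + 1)) in H by ring.
    rewrite Cmod_opp Cmod_R Rabs_pos_eq in H; [|lra].
    fold r in H; lra. }
  apply Rmult_le_reg_r with (Cmod (z + RtoC (x + 1))); [lra|].
  unfold Rdiv; rewrite Rmult_assoc Rinv_l; [|lra].
  rewrite Rmult_1_r; eapply Rle_trans; [exact Hnum|].
  apply Rle_trans with
    ((16 * r ^ 2 + 2 * r) * (/ x - / (x + 1)) * ((x + 1) / 2))%R.
  (* As [(x + 1) / x <= 2], the numerator is at most
     [(8 * r ^ 2 + r) / x]; the lower bound [(x + 1) / 2] of the denominator
     doubles these constants. *)
  - rewrite Hdiff.
    replace ((16 * r ^ 2 + 2 * r) * (/ x * / (x + 1)) * ((x + 1) / 2))%R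
      with (8 * r ^ 2 * / x + r * / x)%R by (field; lra).
    replace ((x + 1) * (4 * (r * / x) ^ 2 + r * (/ x * / (x + 1))))%R
      with (4 * r ^ 2 * / x * (1 + / x) + r * / x)%R by (field; lra).
    assert (/ x <= 1)%R by nra.
    assert (0 <= r ^ 2 * / x)%R
      by (apply Rmult_le_pos; [apply pow2_ge_0|lra]).
    nra.
  - apply Rmult_le_compat_l; [|exact Hdenlow].
    rewrite Hdiff; apply Rmult_le_pos; nra.
Qed.

Lemma Gamma_correct (z : C) :
  ~ Gamma_pole z -> is_Clim_seq (gauss_seq z) (Gamma z).
Proof.
  intros Hz.
  assert (Hex : exists l, is_Clim_seq (gauss_seq z) l).
  { destruct (nfloor_ex (2 * Cmod z)) as [N HN];
      [assert (H := Cmod_ge_0 z); lra|].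
    set (K := (16 * Cmod z ^ 2 + 2 * Cmod z)%R).
    assert (HK : (0 <= K)%R).
    { unfold K; assert (H := Cmod_ge_0 z).
      assert (H' := pow2_ge_0 (Cmod z)); lra. }
    destruct (ex_Clim_seq_relative_increments
                (fun m => gauss_seq z (m + S N)%nat)
                (fun m => (K * / INR (m + S N))%R)) as [l Hl].
    - intros m; apply Rmult_le_compat_l; [exact HK|].
      apply Rinv_le_contravar; [apply lt_0_INR; lia|apply le_INR; lia].
    - apply (is_lim_seq_incr_n (fun m => (K * / INR m)%R)).
      replace (Finite 0) with (Rbar_mult K 0) by (simpl; f_equal; ring).
      apply is_lim_seq_scal_l.
      apply (is_lim_seq_inv INR p_infty); [apply is_lim_seq_INR|easy].
    - intros m; rewrite -Rmult_minus_distr_l.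
      apply gauss_seq_increment_bound; [exact Hz|lia|].
      rewrite plus_INR S_INR; assert (H := pos_INR m); lra.
    - exists l; now apply is_Clim_seq_incr_n with (S N). }
  destruct Hex as [l Hl].
  replace (Gamma z) with l; [exact Hl|].
  symmetry; now apply is_Clim_seq_unique.
Qed.

Lemma Gamma_pole_succ (z : C) : ~ Gamma_pole z -> ~ Gamma_pole (z + 1).
Proof.
  intros Hz [m Hm]; apply Hz; exists (S m).
  rewrite NtoC_S; replace z with (z + 1 - 1) by ring; rewrite Hm; ring.
Qed.

Lemma Cprod_succ_shift (u : nat -> C) (m : nat) :
  Cprod u (S m) = u O * Cprod (fun i => u (S i)) m.
Proof.
  induction m as [|m IH]; [simpl; ring|].
  change (Cprod u (S (S m))) with (Cprod u (S m) * u (S m)).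
  rewrite IH; simpl; ring.
Qed.

Lemma Cprod_ext (u v : nat -> C) (m : nat) :
  (forall i, u i = v i) -> Cprod u m = Cprod v m.
Proof. intros H; induction m as [|m IH]; simpl; congruence. Qed.

Lemma is_Clim_seq_inv_INR : is_Clim_seq (fun m => RtoC (/ INR m)) 0.
Proof.
  apply is_Clim_seq_Re_Im; split; simpl; [|apply is_lim_seq_const].
  apply (is_lim_seq_inv INR p_infty); [apply is_lim_seq_INR|easy].
Qed.

(** The correction factor [1 + (z + 1) / m] tends to [1].  It is kept as a
    multiplier on the right so that no limit of a quotient is needed. *)
Lemma gauss_seq_succ (z : C) (m : nat) :
  ~ Gamma_pole z -> (1 <= m)%nat ->
  z * gauss_seq z m = gauss_seq (z + 1) m * (1 + (z + 1) * RtoC (/ INR m)).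
Proof.
  intros Hz Hm.
  assert (HmR : (0 < INR m)%R) by (apply lt_0_INR; lia).
  assert (HmC : RtoC (INR m) <> 0) by (intros H; apply RtoC_inj in H; lra).
  assert (H0 := Gamma_pole_ne_0 z Hz).
  assert (HP : Cprod (fun i => z + i) (S m) <> 0)
    by (apply Cprod_neq_0; intros i; now apply Gamma_pole_shift).
  assert (HP' : Cprod (fun i => z + 1 + i) (S m) <> 0)
    by (apply Cprod_neq_0; intros i; apply Gamma_pole_shift;
        now apply Gamma_pole_succ).
  assert (Hshift : z * Cprod (fun i => z + 1 + i) (S m)
                   = Cprod (fun i => z + i) (S m) * (z + (m + 1))).
  { rewrite -NtoC_S.
    change (Cprod (fun i => z + i) (S m) * (z + S m))
      with (Cprod (fun i => z + i) (S (S m))).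
    rewrite (Cprod_succ_shift _ (S m)).
    replace (z + O) with z by (unfold NtoC; simpl; ring).
    f_equal; apply Cprod_ext; intros i; rewrite NtoC_S; ring. }
  unfold gauss_seq.
  replace ((z + 1) * RtoC (ln (INR m)))
    with (z * RtoC (ln (INR m)) + RtoC (ln (INR m))) by ring.
  rewrite Cexp_plus Cexp_RtoC exp_ln // RtoC_inv; [|lra].
  revert HP HP' Hshift.
  generalize (Cprod (fun i => z + i) (S m)) (Cprod (fun i => z + 1 + i) (S m)).
  intros P P' HP HP' Hshift; unfold NtoC in Hshift.
  replace P' with (P * (z + (INR m + 1)) / z) in HP' |- *
    by (rewrite -Hshift; field; exact H0).
  field; repeat split; try assumption.
  intros H; apply HP'; unfold Cdiv; rewrite H; ring.
Qed.

Lemma Gamma_succ (z : C) :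
  ~ Gamma_pole z -> Gamma (z + 1) = z * Gamma z.
Proof.
  intros Hz.
  assert (Hz1 := Gamma_correct _ (Gamma_pole_succ z Hz)).
  assert (Hlim : is_Clim_seq (fun m => 1 + (z + 1) * RtoC (/ INR m)) 1).
  { assert (H := is_Clim_seq_mult _ _ _ _ (is_Clim_seq_const (- (z + 1)))
                   is_Clim_seq_inv_INR).
    assert (H' := is_Clim_seq_minus _ _ _ _ (is_Clim_seq_const 1) H).
    replace (1 - - (z + 1) * 0) with (RtoC 1) in H' by ring.
    revert H'; apply is_Clim_seq_ext; intros m; ring. }
  assert (H1 := is_Clim_seq_mult _ _ _ _ Hz1 Hlim).
  assert (H2 := is_Clim_seq_mult _ _ _ _ (is_Clim_seq_const z)
                  (Gamma_correct z Hz)).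
  apply is_Clim_seq_unique in H1; rewrite -(Cmult_1_r (Gamma (z + 1))) -H1.
  apply is_Clim_seq_unique; revert H2; apply is_Clim_seq_ext_loc.
  (* At index 0 the relation fails, [ln 0] and [/ 0] being default values. *)
  exists 1%nat; intros m Hm; now apply gauss_seq_succ.
Qed.

(** * Contiguity relations of the summand *)

Lemma Cinv_0 : / 0 = 0.
Proof. apply injective_projections; simpl; unfold Rdiv; ring. Qed.

Lemma Cinv_mult_total (x y : C) : / (x * y) = / x * / y.
Proof.
  destruct (Ceq_dec x 0) as [->|Hx].
  { rewrite Cmult_0_l Cinv_0; ring. }
  destruct (Ceq_dec y 0) as [->|Hy].
  { rewrite Cmult_0_r Cinv_0; ring. }
  field; now split.
Qed.

Lemma Cinv_inv_total (x : C) : / / x = x.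
Proof.
  destruct (Ceq_dec x 0) as [->|Hx]; [now rewrite !Cinv_0|].
  field; exact Hx.
Qed.

Section Summand.

Context (b c d e f : C).

Notation F := (F b c d e f).

(** Inverting every Gamma value separately is legitimate without knowing that
    the Gamma function has no zeros, since the inverse of [0] is [0]. *)
Lemma F_Gamma (n : C) (k : nat) (a : C) :
  F n k a = Gamma (a + f + k) * / Gamma a * (Gamma (b + e + k) * / Gamma b)
            * (/ Gamma (n + a + d + k) * Gamma n)
            * (/ Gamma (n + c + k) * Gamma n).
Proof.
  unfold Defs.F, rising, Cdiv.
  rewrite !Cinv_mult_total !Cinv_inv_total.
  replace (a + (k + f)) with (a + f + k) by ring.
  replace (b + (k + e)) with (b + e + k) by ring.
  replace (n + (k + d + a)) with (n + a + d + k) by ring.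
  replace (n + (k + c)) with (n + c + k) by ring.
  ring.
Qed.

Lemma F_regular_not_pole (n : C) (k : nat) (a : C) :
  F_regular b c d e f n k a ->
  ~ Gamma_pole a /\ ~ Gamma_pole n /\
  ~ Gamma_pole (a + f + k) /\ ~ Gamma_pole (b + e + k) /\
  ~ Gamma_pole (n + a + d + k) /\ ~ Gamma_pole (n + c + k).
Proof.
  intros [[HA Ha] [[HB _] [[HD Hn] [HC _]]]].
  replace (a + (k + f)) with (a + f + k) in HA by ring.
  replace (b + (k + e)) with (b + e + k) in HB by ring.
  replace (n + (k + d + a)) with (n + a + d + k) in HD by ring.
  replace (n + (k + c)) with (n + c + k) in HC by ring.
  tauto.
Qed.

Lemma F_succ_k (n : C) (k : nat) (a : C) :
  F_regular b c d e f n k a ->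
  F n (S k) a =
  F n k a * ((a + f + k) * (b + e + k) / ((n + a + d + k) * (n + c + k))).
Proof.
  intros (Ha & Hn & HA & HB & HD & HC)%F_regular_not_pole.
  rewrite !F_Gamma NtoC_S !Cplus_assoc.
  rewrite !Gamma_succ // !Cinv_mult_total.
  unfold Cdiv; rewrite Cinv_mult_total; ring.
Qed.

Lemma F_succ_n (n : C) (k : nat) (a : C) :
  F_regular b c d e f n k a ->
  F (n + 1) k a = F n k a * (n ^ 2 / ((n + a + d + k) * (n + c + k))).
Proof.
  intros (Ha & Hn & HA & HB & HD & HC)%F_regular_not_pole.
  rewrite !F_Gamma.
  replace (n + 1 + a + d + k) with (n + a + d + k + 1) by ring.
  replace (n + 1 + c + k) with (n + c + k + 1) by ring.
  rewrite !Gamma_succ // !Cinv_mult_total.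
  unfold Cdiv; rewrite Cinv_mult_total; ring.
Qed.

Lemma F_succ_a (n : C) (k : nat) (a : C) :
  F_regular b c d e f n k a ->
  F n k (a + 1) = F n k a * ((a + f + k) / (a * (n + a + d + k))).
Proof.
  intros (Ha & Hn & HA & HB & HD & HC)%F_regular_not_pole.
  rewrite !F_Gamma.
  replace (a + 1 + f + k) with (a + f + k + 1) by ring.
  replace (n + (a + 1) + d + k) with (n + a + d + k + 1) by ring.
  rewrite !Gamma_succ // !Cinv_mult_total.
  unfold Cdiv; rewrite Cinv_mult_total; ring.
Qed.

(** The contiguity relations make both sides a rational function times
    [F n k a]; with the common denominator cleared, the two rational functions
    agree as polynomials in [k]. *)
Lemma certR_recurrence (n : C) (k : nat) (a : C) :
  F_regular b c d e f n k a ->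
  p1 b c d e f n a * F (n + 1) k a + p2 b c d e f n a * F n k a =
  G b c d e f n (S k) a - G b c d e f n k a.
Proof.
  intros Hreg; unfold G.
  rewrite F_succ_n // F_succ_k //.
  apply F_regular_not_pole in Hreg as (_ & _ & _ & _ & HD & HC).
  apply Gamma_pole_ne_0 in HD, HC.
  unfold certR, p1, p2, pars, parA, parB, parC, parD.
  rewrite NtoC_S.
  field; now split.
Qed.

Lemma calR_recurrence (n : C) (k : nat) (a : C) :
  F_regular b c d e f n k a ->
  p3 b d e n a * F n k (a + 1) + p4 c f n a * F n k a =
  calG b c d e f n (S k) a - calG b c d e f n k a.
Proof.
  intros Hreg; unfold calG.
  rewrite F_succ_a // F_succ_k //.
  apply F_regular_not_pole in Hreg as (Ha & _ & _ & _ & HD & HC).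
  apply Gamma_pole_ne_0 in Ha, HD, HC.
  unfold calR, p3, p4.
  rewrite NtoC_S.
  field; repeat split; assumption.
Qed.

End Summand.

(** * Summation of the recurrences *)

Lemma CSeries_correct (u : nat -> C) :
  ex_Cseries u -> is_Cseries u (CSeries u).
Proof.
  intros [l Hl]; replace (CSeries u) with l; [exact Hl|].
  symmetry; now apply is_Clim_seq_unique.
Qed.

Lemma is_Cseries_unique (u : nat -> C) (l l' : C) :
  is_Cseries u l -> is_Cseries u l' -> l = l'.
Proof.
  intros H H'; transitivity (CSeries u);
    [symmetry|]; now apply is_Clim_seq_unique.
Qed.

Lemma is_Cseries_telescope (w H : nat -> C) (l : C) :
  (forall k, w k = H (S k) - H k) -> is_Clim_seq H l ->
  is_Cseries w (l - H O).
Proof.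
  intros Hw Hl.
  apply (is_Clim_seq_ext (fun m => H (S m) - H O)).
  - induction m as [|m IH].
    + now rewrite sum_O Hw.
    + rewrite sum_Sn -IH Hw; unfold plus; simpl; ring.
  - apply is_Clim_seq_minus; [now apply is_Clim_seq_incr_1|].
    apply is_Clim_seq_const.
Qed.

Lemma CSeries_recurrence (p q : C) (u v H : nat -> C) :
  q <> 0 -> ex_Cseries u -> ex_Cseries v -> is_Clim_seq H 0 ->
  (forall k, p * u k + q * v k = H (S k) - H k) ->
  CSeries v = - (H O / q) + - (p / q) * CSeries u.
Proof.
  intros Hq Hu%CSeries_correct Hv%CSeries_correct HH Hrec.
  assert (Htel := is_Cseries_telescope _ H 0 Hrec HH).
  assert (Hlin : is_Cseries (fun k => p * u k + q * v k)
                            (p * CSeries u + q * CSeries v)).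
  { apply (is_series_plus (fun k => p * u k) (fun k => q * v k));
      [exact (is_series_scal p u _ Hu)|exact (is_series_scal q v _ Hv)]. }
  assert (E := is_Cseries_unique _ _ _ Hlin Htel).
  replace (CSeries v)
    with ((p * CSeries u + q * CSeries v - p * CSeries u) / q)
    by (field; exact Hq).
  rewrite E; field; exact Hq.
Qed.

Lemma frakf_succ_n (b c d e f n a : C) :
  (forall k, F_regular b c d e f n k a) -> p2 b c d e f n a <> 0 ->
  ex_Cseries (fun k : nat => F b c d e f n k a) ->
  ex_Cseries (fun k : nat => F b c d e f (n + 1) k a) ->
  is_Clim_seq (fun k : nat => G b c d e f n k a) 0 ->
  frakf b c d e f n a =
  g1 b c d e f n a + g2 b c d e f n a * frakf b c d e f (n + 1) a.
Proof.
  intros Hreg Hp2 Hn Hn1 HG.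
  exact (CSeries_recurrence (p1 b c d e f n a) (p2 b c d e f n a)
           (fun k => F b c d e f (n + 1) k a) (fun k => F b c d e f n k a)
           (fun k => G b c d e f n k a) Hp2 Hn1 Hn HG
           (fun k => certR_recurrence b c d e f n k a (Hreg k))).
Qed.

Lemma frakf_succ_a (b c d e f n a : C) :
  (forall k, F_regular b c d e f n k a) -> p4 c f n a <> 0 ->
  ex_Cseries (fun k : nat => F b c d e f n k a) ->
  ex_Cseries (fun k : nat => F b c d e f n k (a + 1)) ->
  is_Clim_seq (fun k : nat => calG b c d e f n k a) 0 ->
  frakf b c d e f n a =
  g3 b c d e f n a + g4 b c d e f n a * frakf b c d e f n (a + 1).
Proof.
  intros Hreg Hp4 Ha Ha1 HG.
  exact (CSeries_recurrence (p3 b d e n a) (p4 c f n a)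
           (fun k => F b c d e f n k (a + 1)) (fun k => F b c d e f n k a)
           (fun k => calG b c d e f n k a) Hp4 Ha1 Ha HG
           (fun k => calR_recurrence b c d e f n k a (Hreg k))).
Qed.

(** Iterating [X j = g j + h j * X (j + 1)] is a telescoping of the products
    [h 0 ... h (j - 1) X j]. *)
Lemma is_Cseries_iterate (X g h : nat -> C) :
  (forall j, X j = g j + h j * X (S j)) ->
  is_Clim_seq (fun m => Cprod h (S m) * X (S m)) 0 ->
  is_Cseries (fun j => Cprod h j * g j) (X O).
Proof.
  intros HX Hrem.
  pose (H := fun j => - (Cprod h j * X j)).
  replace (X O) with (0 - H O) by (unfold H; simpl; ring).
  apply is_Cseries_telescope.
  - intros j; unfold H; rewrite (HX j); simpl; ring.
  (* The remainder hypothesis starts at the product of length 1. *)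
  - apply (is_Clim_seq_incr_n _ 1).
    replace (RtoC 0) with (0 - 0) by ring.
    apply (is_Clim_seq_ext (fun m => 0 - Cprod h (S m) * X (S m))).
    + intros m; rewrite Nat.add_1_r; unfold H; ring.
    + apply is_Clim_seq_minus; [apply is_Clim_seq_const|exact Hrem].
Qed.

Theorem theorem2 (a b c d e f n : C)
  (h_regular : forall j k : nat,
     F_regular b c d e f (n + j) k (a + j) /\
     F_regular b c d e f (n + j + 1) k (a + j))
  (h_p2 : forall j : nat, p2 b c d e f (n + j) (a + j) <> 0)
  (h_p4 : forall j : nat, p4 c f (n + j + 1) (a + j) <> 0)
  (h_series : forall j : nat,
     ex_Cseries (fun k : nat => F b c d e f (n + j) k (a + j)) /\
     ex_Cseries (fun k : nat => F b c d e f (n + j + 1) k (a + j)))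
  (h_G : forall j : nat,
     is_Clim_seq (fun k : nat => G b c d e f (n + j) k (a + j)) 0)
  (h_calG : forall j : nat,
     is_Clim_seq (fun k : nat => calG b c d e f (n + j + 1) k (a + j)) 0)
  (h_rem : is_Clim_seq
     (fun m : nat =>
        Cprod (fun i : nat => g6 b c d e f (n + i) (a + i)) (S m)
        * frakf b c d e f (n + m + 1) (a + m + 1)) 0) :
  is_Cseries
    (fun j : nat =>
       Cprod (fun i : nat => g6 b c d e f (n + i) (a + i)) j
       * g5 b c d e f (n + j) (a + j))
    (frakf b c d e f n a).
Proof.
  pose (X := fun j : nat => frakf b c d e f (n + j) (a + j)).
  assert (HXS : forall j, X (S j) = frakf b c d e f (n + j + 1) (a + j + 1))
    by (intros j; unfold X; now rewrite NtoC_S !Cplus_assoc).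
  replace (frakf b c d e f n a) with (X O).
  2:{ unfold X; f_equal; unfold NtoC; simpl; ring. }
  apply (is_Cseries_iterate X
           (fun j => g5 b c d e f (n + j) (a + j))
           (fun j => g6 b c d e f (n + j) (a + j))).
  - intros j; rewrite HXS; unfold X.
    destruct (h_series j) as [Hj Hj1]; destruct (h_series (S j)) as [HSj _].
    rewrite NtoC_S !Cplus_assoc in HSj.
    rewrite frakf_succ_n; [|intros k; apply h_regular|auto..].
    rewrite (frakf_succ_a b c d e f (n + j + 1));
      [|intros k; apply h_regular|auto..].
    unfold g5, g6; ring.
  - revert h_rem; apply is_Clim_seq_ext; intros m; now rewrite HXS.
Qed.
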